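(* Let $q$ be a power of an odd prime. Let $m, k \geq 0$ and $d \geq 1$ be integers with $k \neq d+m$. For $M \in \mathcal{M}_m$, $g \in \mathcal{M}_d$, and $a \in \mathcal{M}_k$ coprime to $M$, define $$D = M^2\left(g + \frac{a}{M}\right)', \quad E = \frac{\mathrm{rad}(D)}{\gcd(M,\mathrm{rad}(D))}, \quad E_1 = \frac{\mathrm{rad}_1(D)}{\gcd(M,\mathrm{rad}_1(D))}.$$ Then $$\mu(a + gM) = S\cdot\chi(w+g)$$ where $w = w_{a,M,g'} \in \mathbb{F}_q[T]$ depends only on $a, M, g'$; $\chi = \chi_{a,M,g'}$ is a real multiplicative character mod $E$ with conductor $E_1$, depending only on $a, M, g'$; and $S = S_{d,a,M,g'} \in \{0,1,-1\}$ depends only on $d, a, M, g'$, with $S = 0$ if and only if $D = 0$. (When $D=0$, $E$ and $E_1$ are not defined and the assertion is that $S=0$ and $\mu(a+gM) = 0$.)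
   Context: $\mathcal{M}_d$ is the set of monic polynomials of degree $d$ in $\mathbb{F}_q[T]$. The prime $'$ denotes the derivative with respect to $T$ (of polynomials and rational functions), so $D = M^2g' + a'M - aM'$ is a polynomial. For nonzero $D$, $\mathrm{rad}(D)$ is the product of the primes (monic irreducibles) that appear in the factorization of $D$, and $\mathrm{rad}_1(D)$ is the product of the primes that appear with odd multiplicity in the factorization of $D$. For monic $f$, $\mu(f) = 0$ if $P^2 \mid f$ for some prime $P$, and otherwise $\mu(f) = (-1)^{\#\{P : P\mid f\}}$. A multiplicative character mod $E$ is a homomorphism $(\mathbb{F}_q[T]/(E))^\times \to \mathbb{C}^\times$ extended by $0$ to polynomials not coprime to $E$; it is real if its values are real. Its conductor is the minimal (monic) modulus dividing $E$ from which it is induced. *)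

(* Defs.v *)
From HB Require Import structures.
From mathcomp Require Import all_boot all_order all_algebra.
From mathcomp Require Import ring.
Set Implicit Arguments.
Unset Strict Implicit.
Unset Printing Implicit Defensive.
Import GRing.Theory.
Local Open Scope ring_scope.

Definition is_prime_poly (F : finFieldType) (P : {poly F}) : bool :=
  (P \is monic) && irreducibleb P.

(* The primes dividing f <> 0 all have size at most [size f], so the finite
   type {poly_(size f) F} contains all of them. *)
Definition moebius (F : finFieldType) (f : {poly F}) : int :=
  if [exists P : {poly_(size f) F}, is_prime_poly P && (val P ^+ 2 %| f)]
  then 0
  else (-1) ^+ #|[pred P : {poly_(size f) F} | is_prime_poly P & val P %| f]|.

(* For f <> 0 and P nonconstant, P ^+ e %| f forces e <= deg f < size f. *)
Definition multiplicity (F : finFieldType) (P f : {poly F}) : nat :=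
  (\max_(e < size f | ((P ^+ e)%R %| f)%R) e)%N.

Definition rad (F : finFieldType) (D : {poly F}) : {poly F} :=
  \prod_(P : {poly_(size D) F} | is_prime_poly P && (val P %| D)) val P.

Definition rad1 (F : finFieldType) (D : {poly F}) : {poly F} :=
  \prod_(P : {poly_(size D) F}
          | is_prime_poly P && odd (multiplicity P D)) val P.

(* [gcdp] is only defined up to a nonzero scalar. *)
Definition monic_gcdp (F : fieldType) (p q : {poly F}) : {poly F} :=
  (lead_coef (gcdp p q))^-1 *: gcdp p q.

Definition fracderiv (F : fieldType) (x : {fraction {poly F}}) :
    {fraction {poly F}} :=
  let n := (frac (repr x)).1 in
  let d := (frac (repr x)).2 in
  tofrac (n^`() * d - n * d^`()) / tofrac d ^+ 2.

(* M ^ 2 (g + a / M)', cleared of denominators (see DpolyE), where h stands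
   for g'. *)
Definition Dpoly (F : fieldType) (a M h : {poly F}) : {poly F} :=
  M ^+ 2 * h + a^`() * M - a * M^`().

Lemma tofrac_numer (R : idomainType) (r : {ratio R}) :
  (\pi_({fraction R})%qT r : {fraction R}) * tofrac (frac r).2 =
  tofrac (frac r).1.
Proof.
have d0 := denom_ratioP r.
unlock FracField.tofrac.
rewrite -[LHS]FracField.pi_mul; apply/eqmodP/eqP => /=.
rewrite /FracField.mulf !numden_Ratio ?mulr1 ?oner_eq0 //.
by rewrite mulrC.
Qed.

Lemma fracderivE (F : fieldType) (n d : {poly F}) : d != 0 ->
  fracderiv (tofrac n / tofrac d) =
  tofrac (n^`() * d - n * d^`()) / tofrac d ^+ 2.
Proof.
move=> d0; rewrite /fracderiv; set x := tofrac n / _.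
have := tofrac_numer (repr x); rewrite reprK.
have := denom_ratioP (repr x).
move: (frac (repr x)).1 (frac (repr x)).2 => u v v0 xE.
have tv0 : tofrac v != 0 by rewrite tofrac_eq0.
have td0 : tofrac d != 0 by rewrite tofrac_eq0.
have nv : n * v = u * d.
  apply/eqP; rewrite -tofrac_eq !tofracM -xE /x.
  by rewrite -mulrA [tofrac v * _]mulrC mulrA divfK.
have nv' := congr1 (@deriv F) nv; rewrite !derivM in nv'.
have tv2 : tofrac v ^+ 2 != 0 by exact: (expf_neq0 2 tv0).
have td2 : tofrac d ^+ 2 != 0 by exact: (expf_neq0 2 td0).
apply: (mulIf td2); rewrite (divfK td2); apply: (mulIf tv2).
rewrite mulrAC (divfK tv2).
rewrite -[tofrac d ^+ 2]tofracXn -[tofrac v ^+ 2]tofracXn.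
rewrite -[LHS]tofracM -[RHS]tofracM; congr (tofrac _).
have -> : (u^`() * v - u * v^`()) * d ^+ 2 =
  (u^`() * d + u * d^`()) * v * d - (u * d) * (d^`() * v + v^`() * d) by ring.
by rewrite -nv' -nv; ring.
Qed.

Lemma DpolyE (F : fieldType) (a M g : {poly F}) : M != 0 ->
  tofrac (Dpoly a M g^`()) =
  tofrac M ^+ 2 * fracderiv (tofrac g + tofrac a / tofrac M).
Proof.
move=> M0; have tM0 : tofrac M != 0 by rewrite tofrac_eq0.
have -> : tofrac g + tofrac a / tofrac M = tofrac (g * M + a) / tofrac M.
  by rewrite tofracD tofracM mulrDl mulfK.
have tM2 : tofrac M ^+ 2 != 0 by exact: (expf_neq0 2 tM0).
rewrite (fracderivE _ M0) mulrC (divfK tM2); congr (tofrac _).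
by rewrite /Dpoly derivD derivM; ring.
Qed.

Definition Emod (F : finFieldType) (a M h : {poly F}) : {poly F} :=
  rad (Dpoly a M h) %/ monic_gcdp M (rad (Dpoly a M h)).

Definition E1mod (F : finFieldType) (a M h : {poly F}) : {poly F} :=
  rad1 (Dpoly a M h) %/ monic_gcdp M (rad1 (Dpoly a M h)).

(* Functions on {poly F} that factor, on the polynomials coprime to E, through
   a group homomorphism from the units of {poly F} modulo E to C^*, and that
   vanish elsewhere. The quotient ring {poly %/ E} is not used because it is
   junk for E = 1, a modulus that does occur. *)
Record mult_char (F : fieldType) (C : fieldType) (E : {poly F})
    (chi : {poly F} -> C) : Prop := MultChar {
  mult_char_mod : forall f g, E %| (f - g) -> chi f = chi g;
  mult_char_neq0 : forall f, coprimep f E -> chi f != 0;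
  mult_char1 : chi 1 = 1;
  mult_charM : forall f g, coprimep f E -> coprimep g E ->
    chi (f * g) = chi f * chi g;
  mult_char_eq0 : forall f, ~~ coprimep f E -> chi f = 0
}.

Definition real_char (F : fieldType) (C : numFieldType)
    (chi : {poly F} -> C) : Prop :=
  forall f, chi f \is Num.real.

Definition induced_from (F : fieldType) (C : fieldType) (E : {poly F})
    (chi : {poly F} -> C) (E' : {poly F}) : Prop :=
  [/\ E' \is monic, E' %| E &
      exists2 psi : {poly F} -> C, mult_char E' psi &
        forall f, coprimep f E -> chi f = psi f].

(* Minimal with respect to divisibility: E0 divides every inducing modulus. *)
Definition is_conductor (F : fieldType) (C : fieldType) (E : {poly F})
    (chi : {poly F} -> C) (E0 : {poly F}) : Prop :=
  induced_from E chi E0 /\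
  (forall E', induced_from E chi E' -> E0 %| E').

(* Main.v *)
From HB Require Import structures.
Require Import Defs.
From mathcomp Require Import all_boot all_order all_algebra all_field.
From mathcomp Require Import ring zify.
From mathcomp Require Import reals complex.
Import GRing.Theory Num.Theory.
Local Open Scope ring_scope.

Set Implicit Arguments.
Unset Strict Implicit.
Unset Printing Implicit Defensive.

(** Let [f = a + g * M], a monic polynomial of degree [n]: the degrees of [a] and
    [g * M] differ, so [n] is the larger one. The definition of [D] gives
    [D = f' * M - f * M'], which is congruent to [f' * M] modulo [f].

    Write (u/P) for the quadratic residue symbol modulo a monic prime [P]. By
    Stickelberger's theorem ([jacobi_deriv]) the product of the symbols (f'/P)
    over the primes [P] of [f] is mu(f) up to a sign that depends only on [n] and
    on [#|F|]. Since f' * M is congruent to [D], mu(f) is, up to that sign, the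
    product of (D/P) and (M/P) over the primes of [f]. Quadratic reciprocity
    ([jacobi_recip]) exchanges the roles ([moebius_jacobi]): the symbols of [M]
    modulo the primes of [f] become symbols of [f], that is of [a], modulo the
    primes of [M], and those of [D] become symbols (f/P) modulo the primes [P] of
    [D], counted with multiplicity; the leading coefficient of [D] enters through
    the [n]-th power of a sign.

    A prime [P] of [D] that divides [M] gives (f/P) = (a/P), which belongs to the
    sign [S]. For the others, choose [w] with [w * M] congruent to [a] modulo [E];
    then (f/P) = (M/P) * ((w + g)/P). So chi is the product of the symbols modulo
    the primes of [D] outside [M], each to the power of its multiplicity. Its
    conductor consists of the primes of odd multiplicity, because every prime
    has nonresidues ([legendre_nonresidue], [conductor_sign_char]). If [D = 0],
    the symbols of [D] vanish, and so does mu(f).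

    Both Stickelberger's theorem and reciprocity follow by induction from the
    case of primes ([legendre_deriv], [legendre_recip]). There the symbol modulo
    [P] is the quadratic character of a norm, i.e. of the product of the values at
    the conjugates y ^ (q ^ i) of a root [y] of [P] in a finite extension
    ([prime_conj], [legendre_res]), and all reduces to products of differences of
    roots and the action of the Frobenius on them. *)

Lemma prime_polyP (F : finFieldType) (P : {poly F}) :
  reflect (P \is monic /\ irreducible_poly P) (is_prime_poly P).
Proof.
by apply: (iffP andP) => -[monP /irreducibleP irrP]; split=> //; exact/irreducibleP.
Qed.

Lemma card_pchar_nat (F : finFieldType) : [pchar F].-nat #|F|.
Proof.
have [p p_pr pF] := finPcharP F; rewrite (card_pprimeChar pF).
rewrite (eq_pnat _ (pcharf_eq pF)) pnatX pnat_id ?(pcharf_prime pF) //.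
Qed.

Lemma two_neq0 (F : finFieldType) : odd #|F| -> 2%:R != 0 :> F.
Proof.
apply: contraL => F2; have pF : 2 \in [pchar F] by rewrite inE F2.
have := card_pchar_nat F; rewrite (eq_pnat _ (pcharf_eq pF)) => /p_natP[[|k] qE].
  by have := finNzRing_gt1 F; rewrite qE.
by rewrite qE expnS oddM.
Qed.

Section Parity.

Variable F : finFieldType.
Local Notation q := #|F|.
Hypothesis q_odd : odd q.

Lemma half_predn_exp n : (q ^ n).-1./2 = ((q.-1)./2 * \sum_(i < n) q ^ i)%N.
Proof.
rewrite predn_exp; have /even_halfK {1}<- : ~~ odd q.-1.
  by move: q_odd (finNzRing_gt1 F); case: q => //= k; rewrite negbK.
by rewrite -doubleMl doubleK.
Qed.

Lemma half_card_exp_gt0 n : (0 < n)%N -> (0 < (q ^ n).-1./2)%N.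
Proof.
case: n => // n _; rewrite half_predn_exp muln_gt0 big_ord_recl /= addn_gt0 andbT.
by move: q_odd (finNzRing_gt1 F); case: q => [|[|[|]]].
Qed.

Lemma half_card_expK n : ((q ^ n).-1./2 * 2)%N = (q ^ n).-1.
Proof.
rewrite muln2 even_halfK //.
have: odd (q ^ n) by rewrite oddX q_odd orbT.
by case: (q ^ n)%N => //= j; rewrite negbK.
Qed.

End Parity.

(** * The quadratic residue symbol *)

(** Euler's criterion is taken as the definition: [P] has
    [#|F| ^ (size P).-1] residue classes. *)
Definition legendre (F : finFieldType) (P f : {poly F}) : int :=
  if P %| f then 0
  else if P %| f ^+ (#|F| ^ (size P).-1).-1./2 - 1 then 1 else -1.

Definition is_sign (a : int) := a \in [:: 0; 1; -1].

Lemma is_signP (a : int) : reflect [\/ a = 0, a = 1 | a = -1] (is_sign a).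
Proof.
rewrite /is_sign !inE; apply: (iffP or3P) => -[/eqP|/eqP|/eqP] ->;
  by [constructor 1 | constructor 2 | constructor 3].
Qed.

Lemma is_signM a b : is_sign a -> is_sign b -> is_sign (a * b).
Proof. by move=> /is_signP[]-> /is_signP[]->. Qed.

Lemma is_signX a k : is_sign a -> is_sign (a ^+ k).
Proof. by move=> sa; elim: k => // k IHk; rewrite exprS is_signM. Qed.

Lemma is_sign_legendre (F : finFieldType) (P f : {poly F}) :
  is_sign (legendre P f).
Proof. by rewrite /legendre; do 2?case: ifP. Qed.

(** An identity between symbols may thus be checked in any field of odd
    characteristic, where Euler's criterion makes them powers. *)
Lemma is_sign_eq (R : nzRingType) (a b : int) : 2%:R != 0 :> R ->
  is_sign a -> is_sign b -> a%:~R = b%:~R :> R -> a = b.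
Proof.
move=> R2; have R1 := oner_neq0 R.
have N1 : -1 != 1 :> R by rewrite eq_sym -subr_eq0 opprK.
by move=> /is_signP[]-> /is_signP[]-> //= /eqP;
   rewrite ?mulrN1z ?mulr1z ?mulr0z ?oppr_eq0 1?eq_sym ?oppr_eq0 ?(negPf R1)
           ?(negPf N1) // eq_sym ?(negPf N1) // ?oppr_eq0 ?(negPf R1).
Qed.

(** * Discriminants *)

Lemma prodrN_ord (R : comNzRingType) n (f : 'I_n -> R) :
  \prod_(i < n) - f i = (-1) ^+ n * \prod_(i < n) f i.
Proof.
under eq_bigr do rewrite -mulN1r.
by rewrite big_split prodr_const card_ord.
Qed.

Definition vandermonde_prod (R : nzRingType) (z : nat -> R) n :=
  \prod_(j < n) \prod_(i < j) (z j - z i).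

Lemma vandermonde_prod_neq0 (R : idomainType) (z : nat -> R) n :
  {in gtn n &, injective z} -> vandermonde_prod z n != 0.
Proof.
move=> z_inj; apply/prodf_neq0 => j _; apply/prodf_neq0 => i _.
have ij := ltn_ord i; have jn := ltn_ord j.
rewrite subr_eq0; apply: contraTneq ij => /z_inj <-; rewrite ?ltnn //.
exact: ltn_trans jn.
Qed.

(** A cyclic shift of [m.+1] points exchanges the order in exactly the [m]
    pairs that contain the point moved from one end to the other. *)
Lemma vandermonde_prod_shift (R : comNzRingType) (z : nat -> R) m :
  z m.+1 = z 0 ->
  vandermonde_prod (z \o succn) m.+1 = (-1) ^+ m * vandermonde_prod z m.+1.
Proof.
move=> zm; rewrite /vandermonde_prod big_ord_recr /=.
rewrite [in RHS]big_ord_recl big_ord0 mul1r.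
under [in RHS]eq_bigr do rewrite big_ord_recl.
rewrite big_split /= mulrA mulrC; congr (_ * _).
rewrite -prodrN_ord; apply: eq_bigr => i _.
by rewrite zm opprB.
Qed.

(** Each unordered pair of indices contributes its difference with both signs. *)
Lemma prod_deriv_roots (R : comNzRingType) (z : nat -> R) n :
  \prod_(i < n) (\prod_(j < n) ('X - (z j)%:P))^`().[z i] =
  (-1) ^+ 'C(n, 2) * vandermonde_prod z n ^+ 2.
Proof.
elim: n => [|n IHn]; first by rewrite /vandermonde_prod !big_ord0 expr1n mulr1.
rewrite [in LHS]big_ord_recr /=; under eq_bigr do rewrite big_ord_recr /=.
set W := \prod_(j < n) ('X - (z j)%:P) in IHn *.
have Wz (i : 'I_n) : W.[z i] = 0.
  by rewrite horner_prod (bigD1 i) //= hornerXsubC subrr mul0r.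
have Wn : W.[z n] = \prod_(i < n) (z n - z i).
  by rewrite horner_prod; apply: eq_bigr => i _; rewrite hornerXsubC.
under eq_bigr => i _ do rewrite derivM derivXsubC mulr1 !hornerE Wz addr0.
rewrite big_split /= IHn big_ord_recr /= -/W derivM derivXsubC mulr1 !hornerE.
rewrite subrr mulr0 add0r Wn /vandermonde_prod big_ord_recr /=.
rewrite binS bin1 exprD.
have -> : \prod_(i < n) (z i - z n) = (-1) ^+ n * \prod_(i < n) (z n - z i).
  by rewrite -prodrN_ord; apply: eq_bigr => i _; rewrite opprB.
by ring.
Qed.

(** * Conjugates over a finite field *)

Section Extension.

Variables (F L : finFieldType) (iota : {rmorphism F -> L}).
Local Notation q := #|F|.
Local Notation "p ^i" := (map_poly iota p) (at level 2, format "p ^i").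

Definition frob (x : L) : L := x ^+ q.

Lemma frobD x y : frob (x + y) = frob x + frob y.
Proof.
by apply: exprDn_pchar; rewrite (eq_pnat _ (fmorph_pchar iota)) card_pchar_nat.
Qed.

Lemma frobM x y : frob (x * y) = frob x * frob y.
Proof. exact: exprMn. Qed.

Lemma frobB x y : frob (x - y) = frob x - frob y.
Proof. by apply: (addIr (frob y)); rewrite -frobD !subrK. Qed.

Lemma frob0 : frob 0 = 0.
Proof. by rewrite /frob expr0n (gtn_eqF (ltnW (finNzRing_gt1 F))). Qed.

Lemma frob_prod I (r : seq I) (f : I -> L) :
  frob (\prod_(i <- r) f i) = \prod_(i <- r) frob (f i).
Proof. by rewrite /frob prodrXl. Qed.

Lemma frob_iota c : frob (iota c) = iota c.
Proof. by rewrite /frob -rmorphXn expf_card. Qed.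

Lemma frob_inj : injective frob.
Proof.
move=> x y /eqP; rewrite -subr_eq0 -frobB expf_eq0 => /andP[_].
by rewrite subr_eq0 => /eqP.
Qed.

Lemma iter_frob i x : iter i frob x = x ^+ (q ^ i).
Proof. by elim: i => //= i ->; rewrite /frob -exprM expnSr. Qed.

(** The base field supplies all [q] roots of ['X^q - 'X]. *)
Lemma frob_fixed x : frob x = x -> exists c, x = iota c.
Proof.
move=> xE; have /(congr1 (map_poly iota)) := finField_genPoly F.
rewrite rmorphB /= map_polyXn map_polyX rmorph_prod /=.
move=> /(congr1 (fun p => p.[x])); rewrite !hornerE [x ^+ _]xE subrr.
move/esym/eqP; rewrite horner_prod prodf_seq_eq0 => /hasP[c _] /=.
by rewrite map_polyXsubC hornerXsubC subr_eq0 => /eqP; exists c.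
Qed.

Lemma horner_frob p x : frob (p^i).[x] = (p^i).[frob x].
Proof.
elim/poly_ind: p => [|p c IHp].
  by rewrite rmorph0 !horner0 frob0.
by rewrite rmorphD rmorphM /= map_polyX map_polyC !hornerE frobD frobM IHp frob_iota.
Qed.

Lemma root_dvdP P y f : irreducible_poly P -> root P^i y ->
  root f^i y = (P %| f).
Proof.
move=> irrP rPy; apply/idP/idP => [rfy|]; last first.
  by rewrite -(dvdp_map iota) => /root_dvdp/(_ rPy).
apply: contraTT rfy => nPf; apply: (coprimep_root _ rPy).
by rewrite coprimep_map irreducible_poly_coprime.
Qed.

Lemma frob_rmorphism : {phi : {rmorphism L -> L} | phi =1 frob}.
Proof.
have frobMM : monoid_morphism frob by split; [exact: expr1n | exact: frobM].
pose Z := GRing.isZmodMorphism.Build L L frob frobB.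
pose M := GRing.isMonoidMorphism.Build L L frob frobMM.
by exists (HB.pack_for {rmorphism L -> L} frob Z M).
Qed.

(** The product of ['X - z] over the conjugates [z] of a root of [P] is fixed by
    the Frobenius, hence is defined over the base field; it divides the
    irreducible [P], hence equals it. *)
Lemma prime_conj (P : {poly F}) (y : L) (n := (size P).-1) :
  is_prime_poly P -> root P^i y ->
  [/\ P^i = \prod_(i < n) ('X - (y ^+ (q ^ i))%:P), y ^+ (q ^ n) = y &
      {in gtn n &, injective (fun i => y ^+ (q ^ i))}].
Proof.
move=> /prime_polyP[monP irrP] rPy.
set m := fingraph.order frob y.
have ym : iter m frob y = y by exact: (iter_order frob_inj).
pose t := traject frob y m; pose Q := \prod_(z <- t) ('X - z%:P).
have Qfrob c : frob Q`_c = Q`_c.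
  have [phi phiE] := frob_rmorphism.
  suff /(congr1 (fun p : {poly L} => p`_c)) : map_poly phi Q = Q.
    by rewrite coef_map /= phiE.
  rewrite /Q rmorph_prod /=; under eq_bigr do rewrite map_polyXsubC phiE.
  rewrite -(big_map frob xpredT (fun z => 'X - z%:P)).
  have Xy0 : 'X - y%:P != 0 by rewrite polyXsubC_eq0.
  apply: (mulfI Xy0).
  have -> : map frob t = traject frob (frob y) m.
    by rewrite /t; elim: (m) (y) => //= k IHk z; rewrite IHk.
  rewrite -(big_cons _ _ y _ xpredT (fun z => 'X - z%:P)) -trajectS trajectSr ym.
  by rewrite big_rcons /= mulrC.
have [Q0 QE] : exists Q0, Q = Q0^i.
  have ex c : exists d, Q`_c == iota d.
    by have [d ->] := frob_fixed (Qfrob c); exists d.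
  exists (\poly_(i < size Q) xchoose (ex i)); apply/polyP => c.
  rewrite coef_map coef_poly; case: ltnP => [_|lec]; first exact/eqP/(xchooseP (ex c)).
  by rewrite /= rmorph0 nth_default.
have rQ : all (root P^i) t.
  apply/allP => z /trajectP[k _ ->]; elim: k => //= k IHk.
  by rewrite rootE -horner_frob (rootP IHk) frob0.
have Q0P : Q0 %| P.
  rewrite -(dvdp_map iota) -QE; apply: uniq_roots_dvdp => //.
  by rewrite uniq_rootsE; exact: orbit_uniq.
have sQ : size Q = m.+1 by rewrite size_prod_XsubC size_traject.
have sQ0 : size Q0 = m.+1 by rewrite -sQ QE size_map_poly.
have Q0E : Q0 = P.
  apply/eqP; rewrite -eqp_monic //.
    by apply: (apply_irredp irrP _ Q0P); rewrite sQ0 eqSS -lt0n order_gt0.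
  by rewrite -(map_monic iota) -QE monic_prod_XsubC.
have mE : n = m by rewrite /n -Q0E sQ0.
split; first last.
- move=> i j; rewrite -!topredE /= mE => im jm /eqP; rewrite -!iter_frob.
  rewrite -(nth_traject _ im) -(nth_traject _ jm) nth_uniq ?size_traject //.
    by move/eqP.
  exact: orbit_uniq.
- by rewrite mE -iter_frob.
rewrite -Q0E -QE mE /Q /t (big_nth y) size_traject big_mkord.
by apply: eq_bigr => i _; rewrite nth_traject // iter_frob.
Qed.

Lemma horner_conj p x k : (p^i).[x ^+ (q ^ k)] = (p^i).[x] ^+ (q ^ k).
Proof.
by rewrite -!iter_frob; elim: k => //= k IHk; rewrite -horner_frob IHk.
Qed.

Hypothesis q_odd : odd q.

(** Evaluation at a root of [P] embeds the residue field of [P] in [L], where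
    Euler's criterion becomes an equality. *)
Lemma legendreE P y f : is_prime_poly P -> root P^i y ->
  (legendre P f)%:~R = (f^i).[y] ^+ (q ^ (size P).-1).-1./2.
Proof.
move=> prP rPy; have [_ yq _] := prime_conj prP rPy.
case/prime_polyP: prP => monP irrP; set k := (_.-1)./2; set u := (f^i).[y].
have k_gt0 : (0 < k)%N.
  by apply: half_card_exp_gt0 => //; case: irrP; case: size => [|[]].
rewrite /legendre -/k -(root_dvdP f irrP rPy) -(root_dvdP _ irrP rPy).
rewrite !rootE rmorphB rmorphXn rmorph1 hornerD hornerN horner_exp hornerC -/u.
rewrite subr_eq0; case: eqP => [->|/eqP u0]; first by rewrite expr0n gtn_eqF.
case: eqP => [-> //|/eqP uk1].
have : u ^+ (q ^ (size P).-1).-1 = 1.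
  apply: (mulfI u0); rewrite mulr1 -exprS prednK ?expn_gt0 ?(ltnW (finNzRing_gt1 F)) //.
  by rewrite -horner_conj yq.
rewrite -half_card_expK // -/k exprM => /eqP; rewrite sqrf_eq1 (negPf uk1) /= => /eqP->.
by rewrite mulrN1z.
Qed.

(** The exponent [(q ^ n - 1) / 2] is [(q - 1) / 2] times
    [1 + q + ... + q ^ (n - 1)], so the symbol is the quadratic character of
    [F] at the norm of [f], i.e. at the resultant of [P] and [f]. *)
Lemma legendre_res P y f : is_prime_poly P -> root P^i y ->
  (legendre P f)%:~R =
  (\prod_(i < (size P).-1) (f^i).[y ^+ (q ^ i)]) ^+ (q.-1)./2.
Proof.
move=> prP rPy; rewrite (legendreE _ prP rPy) half_predn_exp //.
under [in RHS]eq_bigr do rewrite horner_conj.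
by rewrite prodrXr -exprM mulnC.
Qed.

End Extension.

(** * Quadratic reciprocity *)

(** Reciprocity compares the roots of two primes, so they have to lie in a
    common finite field. *)
Lemma root_extension (F : finFieldType) (P Q : {poly F}) :
  (1 < size P)%N -> (1 < size Q)%N ->
  exists (L : finFieldType) (iota : {rmorphism F -> L}) (y z : L),
    root (map_poly iota P) y /\ root (map_poly iota Q) z.
Proof.
move=> sP sQ; have P0 : P != 0 by rewrite -size_poly_gt0 ltnW.
have Q0 : Q != 0 by rewrite -size_poly_gt0 ltnW.
have [L [rs PQE _]] := FinSplittingFieldFor (mulf_neq0 P0 Q0).
have rootE (p : {poly F}) : (1 < size p)%N -> p %| P * Q ->
    exists y, root (map_poly (GRing.in_alg L) p) y.
  move=> sp; rewrite -(dvdp_map (GRing.in_alg L)) (eqp_dvdr _ PQE).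
  case/dvdp_prod_XsubC=> m pE.
  case: (mask m rs) pE => [|y s] pE.
    by have := eqp_size pE; rewrite size_map_poly big_nil size_poly1 => /eqP; rewrite gtn_eqF.
  by exists y; rewrite (eqp_root pE) root_prod_XsubC mem_head.
have [y ry] := rootE P sP (dvdp_mulr _ (dvdpp P)).
have [z rz] := rootE Q sQ (dvdp_mull _ (dvdpp Q)).
by exists (FinFieldExtType L), (GRing.in_alg L), y, z.
Qed.

(** Euler's criterion for [-1], a constant of [F]. *)
Definition qchar_opp1 (F : finFieldType) : int := (-1) ^+ (#|F|.-1)./2.

Lemma qchar_opp1_sqr (F : finFieldType) : qchar_opp1 F ^+ 2 = 1.
Proof. exact: sqrr_sign. Qed.

Section Legendre.

Variable F : finFieldType.
Hypothesis q_odd : odd #|F|.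
Implicit Types P Q f g : {poly F}.

Lemma prime_size_gt1 P : is_prime_poly P -> (1 < size P)%N.
Proof. by case/prime_polyP=> _ []. Qed.

Lemma root_extension1 P : is_prime_poly P ->
  exists (L : finFieldType) (iota : {rmorphism F -> L}) (y : L),
    root (map_poly iota P) y /\ 2%:R != 0 :> L.
Proof.
move=> /prime_size_gt1 sP; have [L [iota [y [_ [ry _]]]]] := root_extension sP sP.
exists L, iota, y; split=> //.
by rewrite -(rmorph_nat iota) fmorph_eq0 two_neq0.
Qed.

Lemma legendre_eq0 P f : (legendre P f == 0) = (P %| f).
Proof. by rewrite /legendre; do 2?case: ifP. Qed.

Lemma legendre_sqr P f : ~~ (P %| f) -> legendre P f ^+ 2 = 1.
Proof. by rewrite /legendre => /negPf->; case: ifP. Qed.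

Lemma legendre_mod P f g : is_prime_poly P -> P %| f - g ->
  legendre P f = legendre P g.
Proof.
move=> prP Pfg; have [L [iota [y [ry L2]]]] := root_extension1 prP.
apply: (is_sign_eq L2); rewrite ?is_sign_legendre //.
rewrite !(legendreE q_odd _ prP ry); congr (_ ^+ _).
have [_ irrP] := prime_polyP _ prP.
move: Pfg; rewrite -(root_dvdP _ irrP ry) rmorphB rootE hornerD hornerN subr_eq0.
by move/eqP.
Qed.

Lemma legendreM P f g : is_prime_poly P ->
  legendre P (f * g) = legendre P f * legendre P g.
Proof.
move=> prP; have [L [iota [y [ry L2]]]] := root_extension1 prP.
apply: (is_sign_eq L2); rewrite ?is_signM ?is_sign_legendre //.
by rewrite intrM !(legendreE q_odd _ prP ry) rmorphM hornerM exprMn.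
Qed.

Lemma legendre1 P : is_prime_poly P -> legendre P 1 = 1.
Proof.
move=> prP; rewrite /legendre expr1n subrr dvdp0 dvdp1.
by rewrite gtn_eqF ?prime_size_gt1.
Qed.

Lemma is_prime_polyX : is_prime_poly ('X : {poly F}).
Proof.
apply/prime_polyP; rewrite monicX; split=> //.
by rewrite -['X]subr0; exact: irredp_XsubC.
Qed.

(** The norm of a constant is a power of it. Modulo ['X] the residue field is
    [F], so [legendre 'X c%:P] is the quadratic character of [F] at [c]. *)
Lemma legendre_polyC P c : is_prime_poly P ->
  legendre P c%:P = legendre 'X c%:P ^+ (size P).-1.
Proof.
move=> prP; have sX : (1 < size ('X : {poly F}))%N by rewrite size_polyX.
have [L [iota [y [z [ry rz]]]]] := root_extension (prime_size_gt1 prP) sX.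
have L2 : 2%:R != 0 :> L by rewrite -(rmorph_nat iota) fmorph_eq0 two_neq0.
apply: (is_sign_eq L2); rewrite ?is_signX ?is_sign_legendre //.
rewrite rmorphXn /= (legendre_res q_odd _ prP ry) (legendre_res q_odd _ is_prime_polyX rz).
rewrite size_polyX big_ord1 map_polyC /= hornerC; under eq_bigr do rewrite hornerC.
by rewrite prodr_const card_ord -!exprM mulnC.
Qed.

(** Up to a sign, the norm of [P'] is the square of the Vandermonde product [V]
    of the conjugates of a root. As [V] need not lie in [F], this square need not
    be one in [F]: the Frobenius permutes the conjugates in an [n]-cycle, hence
    multiplies [V] by [(-1) ^+ n.-1]. *)
Lemma legendre_deriv P (n := (size P).-1) : is_prime_poly P ->
  legendre P P^`() = (-1) ^+ n.-1 * qchar_opp1 F ^+ 'C(n, 2).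
Proof.
move=> prP; have [L [iota [y [ry L2]]]] := root_extension1 prP.
apply: (is_sign_eq L2); rewrite ?is_sign_legendre //.
  by rewrite is_signM ?is_signX.
rewrite (legendre_res q_odd _ prP ry) -deriv_map.
have [-> yq z_inj] := prime_conj prP ry; rewrite -/n in yq z_inj *.
pose z i := y ^+ (#|F| ^ i); rewrite (prod_deriv_roots z n).
rewrite exprMn -!exprM mul2n even_halfK; last first.
  by move: q_odd (finNzRing_gt1 F); case: #|F| => //= k; rewrite negbK.
have n_gt0 : (0 < n)%N by have := prime_size_gt1 prP; rewrite /n; case: size => [|[]].
have V0 : vandermonde_prod z n != 0 by exact: vandermonde_prod_neq0.
set V := vandermonde_prod z n in V0 *.
(* V ^+ (#|F| - 1) is the factor by which the Frobenius multiplies V. *)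
have VE : V ^+ #|F|.-1 = (-1) ^+ n.-1.
  apply: (mulIf V0); rewrite -exprSr prednK ?(ltnW (finNzRing_gt1 F)) //.
  rewrite /V; case: (n) n_gt0 yq => // m _ yq /=.
  rewrite -vandermonde_prod_shift; last by rewrite /z yq expr1.
  rewrite -[LHS]/(frob F _) /vandermonde_prod frob_prod; apply: eq_bigr => j _.
  rewrite frob_prod; apply: eq_bigr => i _.
  by rewrite (frobB iota) /frob /z /= -!exprM -!expnSr.
rewrite VE mulrC rmorphM !rmorphXn rmorphN1.
by rewrite (mulnC 'C(n, 2)).
Qed.

(** Both sides are the quadratic character of the product of the differences
    between the roots of [P] and those of [Q], up to the order in the
    differences. *)
Lemma legendre_recip P Q : is_prime_poly P -> is_prime_poly Q ->
  legendre P Q = qchar_opp1 F ^+ ((size P).-1 * (size Q).-1) * legendre Q P.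
Proof.
move=> prP prQ.
have [L [iota [y [z [ry rz]]]]] :=
  root_extension (prime_size_gt1 prP) (prime_size_gt1 prQ).
have L2 : 2%:R != 0 :> L by rewrite -(rmorph_nat iota) fmorph_eq0 two_neq0.
apply: (is_sign_eq L2); rewrite ?is_signM ?is_signX ?is_sign_legendre //.
rewrite intrM (legendre_res q_odd _ prP ry) (legendre_res q_odd _ prQ rz).
have [-> _ _] := prime_conj prP ry; have [-> _ _] := prime_conj prQ rz.
set n := (size P).-1; set m := (size Q).-1.
under eq_bigr => i _ do [rewrite horner_prod; under eq_bigr do rewrite hornerXsubC -opprB].
under [in RHS]eq_bigr => i _ do [rewrite horner_prod; under eq_bigr do rewrite hornerXsubC].
under eq_bigr do rewrite prodrN_ord.
rewrite big_split prodr_const card_ord /= exchange_big /= exprMn; congr (_ * _).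
by rewrite !rmorphXn rmorphN1 -!exprM mulnA mulnC (mulnC m).
Qed.

(** Otherwise all [q ^ n - 1] nonzero residues would be roots of the polynomial
    ['X^((q ^ n - 1) / 2) - 1]. *)
Lemma legendre_nonresidue P : is_prime_poly P -> exists f, legendre P f = -1.
Proof.
move=> prP; have [L [iota [y [ry L2]]]] := root_extension1 prP.
have [_ irrP] := prime_polyP _ prP; have sP := prime_size_gt1 prP.
set n := (size P).-1; set k := (#|F| ^ n).-1./2.
pose T := {poly_n F}.
suff /existsP[f /eqP fE] : [exists f : T, legendre P (val f) == -1] by exists (val f).
apply: contraT => /existsPn no.
pose ev (f : T) := (map_poly iota (val f)).[y].
have dvdT (f : {poly F}) : (size f <= n)%N -> P %| f -> f = 0.
  move=> sf /dvdp_leq Pf; apply/eqP; apply: contraTT sf => f0.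
  by rewrite -ltnNge (leq_trans _ (Pf f0)) // /n prednK // ltnW.
have ev_inj : injective ev.
  move=> f g /eqP; rewrite -subr_eq0 -hornerN -hornerD -rmorphB -rootE.
  rewrite (root_dvdP _ irrP ry) => /dvdT fg; apply/val_inj/eqP.
  rewrite -subr_eq0; apply/eqP/fg; rewrite (leq_trans (size_polyD _ _)) //.
  by rewrite size_polyN geq_max !size_npoly.
pose rs := map ev (rem (0 : T) (enum predT)).
have k_gt0 : (0 < k)%N by rewrite half_card_exp_gt0 // /n -subn1 subn_gt0.
have rk : all (root ('X^k - 1)) rs.
  apply/allP => x /mapP[f]; rewrite mem_rem_uniq ?enum_uniq // inE => /andP[f0 _] ->.
  have nPf : ~~ (P %| val f).
    by apply: contra f0 => /(dvdT _ (size_npoly f)) vf; exact/eqP/val_inj.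
  rewrite rootE hornerD hornerN hornerXn hornerC subr_eq0.
  rewrite -(legendreE q_odd _ prP ry); have := no f.
  by rewrite /legendre (negPf nPf); case: ifP.
have sk : size ('X^k - 1 : {poly L}) = k.+1 by rewrite size_XnsubC.
have := max_poly_roots _ rk _; rewrite -size_poly_gt0 sk => /(_ isT).
rewrite map_inj_uniq // rem_uniq ?enum_uniq // => /(_ isT).
rewrite size_map size_rem ?mem_enum // -cardT card_npoly ltnS.
by rewrite -(half_card_expK q_odd) -/k; lia.
Qed.

End Legendre.

(** * Factorization into monic primes *)

Section Factorization.

Variable F : finFieldType.
Implicit Types (P Q f g M D : {poly F}) (s t : seq {poly F}).
Local Notation prime_poly := (@is_prime_poly F).

Lemma prime_poly_neq0 P : prime_poly P -> P != 0.
Proof. by case/prime_polyP=> /monic_neq0. Qed.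

Lemma prime_poly_monic P : prime_poly P -> P \is monic.
Proof. by case/prime_polyP. Qed.

Lemma all_prime_filter (a : pred {poly F}) s :
  all prime_poly s -> all prime_poly (filter a s).
Proof.
by move=> /allP prs; apply/allP => P; rewrite mem_filter => /andP[_ /prs].
Qed.

Lemma monic_prod_primes s (a : pred {poly F}) : all prime_poly s ->
  \prod_(P <- s | a P) P \is monic.
Proof.
move=> /allP prs; rewrite big_seq_cond; apply: monic_prod => P /andP[/prs prP _].
exact: prime_poly_monic.
Qed.

Lemma prime_poly_coprime P f : prime_poly P -> coprimep P f = ~~ (P %| f).
Proof. by case/prime_polyP=> _ irrP; exact: irreducible_poly_coprime. Qed.

Lemma prime_dvdM P f g : prime_poly P -> (P %| f * g) = (P %| f) || (P %| g).
Proof.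
move=> prP; have [Pf|nPf] := boolP (P %| f); first by rewrite dvdp_mulr.
by rewrite Gauss_dvdpr // prime_poly_coprime.
Qed.

Lemma prime_dvd_prime P Q : prime_poly P -> prime_poly Q -> (P %| Q) = (P == Q).
Proof.
move=> prP prQ; apply/idP/eqP => [PQ|-> //]; apply/eqP.
have [_ irrQ] := prime_polyP _ prQ.
rewrite -eqp_monic ?prime_poly_monic //; apply: (apply_irredp irrQ) => //.
by rewrite gtn_eqF // prime_size_gt1.
Qed.

Lemma prime_dvd_prod P s : prime_poly P -> all prime_poly s ->
  (P %| \prod_(Q <- s) Q) = (P \in s).
Proof.
move=> prP; elim: s => [_|Q s IHs /= /andP[prQ /IHs sE]].
  by rewrite big_nil dvdp1 gtn_eqF // prime_size_gt1.
by rewrite big_cons prime_dvdM // sE prime_dvd_prime.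
Qed.

Lemma prime_exp_dvd_prod P s e : prime_poly P -> all prime_poly s ->
  (P ^+ e %| \prod_(Q <- s) Q) = (e <= count_mem P s)%N.
Proof.
move=> prP; elim: s e => [|Q s IHs] e /=.
  rewrite big_nil dvdp1 => _; case: e => [|e]; first by rewrite expr0 size_poly1.
  rewrite gtn_eqF // (leq_trans (prime_size_gt1 prP)) // dvdp_leq ?dvdp_exp //.
  by rewrite expf_neq0 ?prime_poly_neq0.
case/andP=> prQ prs; rewrite big_cons eq_sym; have [PQ|PQ] := eqVneq P Q.
  case: e => [|e]; first by rewrite expr0 dvd1p.
  by rewrite exprS -PQ dvdp_mul2l ?prime_poly_neq0 // IHs.
rewrite Gauss_dvdpr ?IHs // coprimep_expl //.
by rewrite prime_poly_coprime // prime_dvd_prime.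
Qed.

Lemma coprime_prod_primes f s : all prime_poly s ->
  coprimep f (\prod_(P <- s) P) = all (fun P => ~~ (P %| f)) s.
Proof.
elim: s => [|P s IHs] /=; first by rewrite big_nil coprimep1.
case/andP=> prP /IHs sE; rewrite big_cons coprimepMr sE.
by rewrite coprimep_sym prime_poly_coprime.
Qed.

Lemma prod_primes_dvd s f : uniq s -> all prime_poly s ->
  (\prod_(P <- s) P %| f) = all (fun P => P %| f) s.
Proof.
elim: s => [|P s IHs] /=; first by rewrite big_nil dvd1p.
case/andP=> Ps us /andP[prP prs]; rewrite big_cons Gauss_dvdp ?IHs //.
by rewrite prime_poly_coprime // prime_dvd_prod.
Qed.

Lemma prime_factorization f : f != 0 ->
  exists s, all prime_poly s && (f == lead_coef f *: \prod_(P <- s) P).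
Proof.
have [n] := ubnP (size f); elim: n => // n IHn in f *; rewrite ltnS => sf f0.
have [sf1|sf1] := leqP (size f) 1.
  exists [::]; rewrite big_nil /= (size1_polyC sf1) lead_coefC alg_polyC.
  exact: eqxx.
have [irrf|] := boolP (irreducibleb f).
  have l0 : lead_coef f != 0 by rewrite lead_coef_eq0.
  exists [:: (lead_coef f)^-1 *: f]; rewrite big_seq1 scalerA divff // scale1r eqxx.
  rewrite andbT /= andbT; apply/prime_polyP; split.
    by rewrite monicE lead_coefZ mulVf.
  have [_ irr] := irreducibleP _ irrf; split=> [|g sg].
    by rewrite size_scale ?invr_eq0.
  rewrite dvdpZr ?invr_eq0 // => gf; apply: eqp_trans (irr _ sg gf) _.
  by rewrite eqp_sym eqp_scale ?invr_eq0.
rewrite /irreducibleb sf1 /= => /forallPn[/= g].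
rewrite negb_imply -ltnNge -Pdiv.Idomain.dvdpE => /andP[gf sg].
have /divpK fE := gf; set h := f %/ g in fE.
have g0 : polyn g != 0 by rewrite -size_poly_gt0 ltnW.
have h0 : h != 0 by apply: contraNneq f0 => h0; rewrite -fE h0 mul0r.
have sgf : (size g < size f)%N.
  by rewrite (leq_ltn_trans (size_npoly g)) // prednK // ltnW.
have shf : (size h < size f)%N.
  have := size_mul h0 g0; rewrite fE => ->.
  by move: (size g) sg (size h) => [|[|i]] // _ j; rewrite addnS /=; lia.
have [s /andP[prs /eqP sE]] := IHn _ (leq_trans sgf sf) g0.
have [t /andP[prt /eqP tE]] := IHn _ (leq_trans shf sf) h0.
exists (t ++ s); rewrite all_cat prt prs /= big_cat /=; apply/eqP.
by rewrite -fE lead_coefM {1}tE {1}sE -scalerAl -scalerAr scalerA.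
Qed.

Definition prime_factors f : seq {poly F} :=
  if @idP (f != 0) is ReflectT f0 then xchoose (prime_factorization f0) else [::].

Lemma prime_factorsP f : f != 0 ->
  all prime_poly (prime_factors f) /\
  f = lead_coef f *: \prod_(P <- prime_factors f) P.
Proof.
rewrite /prime_factors; case: {-}_ / idP => // f0 _.
by have /andP[? /eqP] := xchooseP (prime_factorization f0).
Qed.

Section ScaledProduct.

Variables (c : F) (s : seq {poly F}).
Hypotheses (c0 : c != 0) (prs : all prime_poly s).
Let f := c *: \prod_(P <- s) P.

Let f_neq0 : f != 0.
Proof. by rewrite scaler_eq0 negb_or c0 monic_neq0 // monic_prod_primes. Qed.

Lemma prime_dvd_factors P : prime_poly P -> (P %| f) = (P \in s).
Proof. by move=> prP; rewrite dvdpZr // prime_dvd_prod. Qed.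

(** Every prime factor of [f] lives in the finite type of polynomials of size
    at most [size f]. *)
Lemma perm_npoly_primes (a : pred {poly F}) : subpred a (mem s) ->
  perm_eq (map val (enum [pred P : {poly_(size f) F} | prime_poly P & a (val P)]))
          [seq P <- undup s | a P].
Proof.
move=> as_; apply: uniq_perm.
- by rewrite (map_inj_uniq val_inj) enum_uniq.
- by rewrite filter_uniq ?undup_uniq.
move=> P; rewrite mem_filter mem_undup; apply/mapP/andP => [[Q]|[aP Ps]].
  by rewrite mem_enum inE => /andP[_ aQ] ->; split=> //; exact: as_.
have prP := allP prs _ Ps.
have sP : (size P <= size f)%N by rewrite dvdp_leq // prime_dvd_factors.
by exists (NPoly sP); rewrite // mem_enum inE /= prP.
Qed.

Lemma prod_npoly_primes (a : pred {poly F}) : subpred a (mem s) ->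
  \prod_(P : {poly_(size f) F} | prime_poly P && a (val P)) val P =
  \prod_(P <- undup s | a P) P.
Proof.
move=> as_; rewrite -big_filter -(perm_big _ (perm_npoly_primes as_)) big_map.
by rewrite big_enum.
Qed.

Lemma multiplicity_factors P : prime_poly P -> multiplicity P f = count_mem P s.
Proof.
move=> prP; have expE e : (P ^+ e %| f) = (e <= count_mem P s)%N.
  by rewrite dvdpZr // prime_exp_dvd_prod.
apply/eqP; rewrite eqn_leq /multiplicity; apply/andP; split.
  by apply/bigmax_leqP => e; rewrite expE.
have cf : (count_mem P s < size f)%N.
  have : P ^+ count_mem P s %| f by rewrite expE.
  move/dvdp_leq => /(_ f_neq0); apply: leq_trans.
  have := size_exp P (count_mem P s); have := prime_size_gt1 prP.
  have : P ^+ count_mem P s != 0 by rewrite expf_neq0 ?prime_poly_neq0.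
  by rewrite -size_poly_gt0; case: (size P) => [|[|k]] //; case: (size _) => //= j _ _ ->; nia.
by apply: (leq_bigmax_cond (Ordinal cf)); rewrite expE.
Qed.

Lemma rad_factors : Defs.rad f = \prod_(P <- undup s) P.
Proof.
have as_ : subpred (fun P => prime_poly P && (P %| f)) (mem s).
  by move=> P /andP[prP]; rewrite prime_dvd_factors.
rewrite /Defs.rad; transitivity (\prod_(P <- undup s | prime_poly P && (P %| f)) P).
  by rewrite -prod_npoly_primes //; apply: eq_bigl => P; rewrite andbA andbb.
rewrite [RHS]big_seq_cond big_seq_cond; apply: eq_bigl => P; rewrite mem_undup.
by case Ps : (P \in s) => //=; rewrite (allP prs) // prime_dvd_factors // (allP prs).
Qed.

Lemma rad1_factors :
  rad1 f = \prod_(P <- undup s | odd (count_mem P s)) P.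
Proof.
have odds : subpred (fun P => odd (count_mem P s)) (mem s).
  by move=> P /=; apply: contraTT => /count_memPn->.
rewrite -prod_npoly_primes //; apply: eq_bigl => P; apply: andb_id2l => prP.
by rewrite multiplicity_factors.
Qed.

End ScaledProduct.

Lemma moebius_prod s : all prime_poly s ->
  moebius (\prod_(P <- s) P) = if uniq s then (-1) ^+ size s else 0.
Proof.
move=> prs; rewrite -[\prod_(P <- s) P]scale1r; set f := _ *: _.
have c0 := oner_neq0 F.
have f0 : f != 0 by rewrite /f scale1r monic_neq0 // monic_prod_primes.
have expE P e : prime_poly P -> (P ^+ e %| f) = (e <= count_mem P s)%N.
  by move=> prP; rewrite /f scale1r prime_exp_dvd_prod.
rewrite /moebius; have [us|nus] := boolP (uniq s).
  rewrite ifN; last first.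
    apply/existsPn => P; apply/negP => /andP[prP].
    by rewrite expE // count_uniq_mem //; case: (_ \in _).
  have ss : subpred (fun P => prime_poly P && (P %| f)) (mem s).
    by move=> P /andP[prP]; rewrite (prime_dvd_factors c0).
  have /perm_size := perm_npoly_primes c0 prs ss; rewrite size_map -cardE.
  rewrite size_filter (eq_in_count (a2 := predT)).
    rewrite count_predT undup_id // -/f => <-; congr (_ ^+ _).
    by apply: eq_card => P; rewrite !inE andbA andbb.
  move=> P; rewrite mem_undup => Ps; rewrite (allP prs) //=.
  by rewrite (prime_dvd_factors c0) // (allP prs).
rewrite ifT //; have /existsP[/= P] : [exists P : seq_sub s, (1 < count_mem (val P) s)%N].
  apply: contraR nus => /existsPn cs; apply: count_mem_uniq => P.
  have [Ps|/count_memPn-> //] := boolP (P \in s).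
  have := cs (SeqSub Ps); rewrite /= -leqNgt.
  by rewrite -has_pred1 has_count in Ps; case: (count_mem P s) Ps => [|[]].
move=> cP; have Ps := valP P; set Q := val P in cP Ps.
have prQ := allP prs _ Ps.
have sQ : (size Q <= size f)%N by rewrite dvdp_leq // (prime_dvd_factors c0).
by apply/existsP; exists (NPoly sQ); rewrite /= prQ expE.
Qed.

(** The primes that divide [M] make up the greatest common divisor, since each
    prime occurs once in the product. *)
Lemma prod_primes_div_gcd M s : M != 0 -> uniq s -> all prime_poly s ->
  (\prod_(P <- s) P) %/ monic_gcdp M (\prod_(P <- s) P) =
  \prod_(P <- s | ~~ (P %| M)) P.
Proof.
move=> M0 us prs; rewrite (bigID (fun P => P %| M)) /=.
set A := \prod_(P <- s | P %| M) P; set B := \prod_(P <- s | _) P.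
have monA : A \is monic by exact: monic_prod_primes.
have gE : gcdp M (A * B) %= A.
  have coMB : coprimep M B.
    rewrite /B -big_filter coprime_prod_primes; first exact: filter_all.
    exact: all_prime_filter.
  apply: eqp_trans (Gauss_gcdpl _ coMB) _; apply: dvdp_gcd_idr.
  rewrite /A -big_filter prod_primes_dvd ?filter_uniq //; first exact: filter_all.
  exact: all_prime_filter.
have -> : monic_gcdp M (A * B) = A.
  rewrite /monic_gcdp; apply/eqP; rewrite -eqp_monic //.
    apply: eqp_trans gE; rewrite eqp_scale // invr_eq0 lead_coef_eq0 gcdp_eq0.
    by rewrite (negPf M0).
  rewrite monicE lead_coefZ mulVf // lead_coef_eq0 gcdp_eq0.
  by rewrite (negPf M0).
by rewrite mulKp // monic_neq0.
Qed.

End Factorization.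

(** * Characters with squarefree modulus *)

Section Character.

Variable F : finFieldType.
Hypothesis q_odd : odd #|F|.
Implicit Types (P Q f g h M : {poly F}) (s t u : seq {poly F}) (v : {poly F} -> nat).
Local Notation prime_poly := (@is_prime_poly F).

Definition sign_char s v h : int := \prod_(P <- s) legendre P h ^+ v P.

Lemma sign_char_sqr s v h : all (fun P => ~~ (P %| h)) s ->
  sign_char s v h ^+ 2 = 1.
Proof.
move=> /allP sh; rewrite /sign_char -prodrXl big_seq big1 // => P /sh nPh.
by rewrite exprAC legendre_sqr // expr1n.
Qed.

Lemma is_sign_char s v h : is_sign (sign_char s v h).
Proof.
rewrite /sign_char; elim: s => [|P s IHs]; rewrite ?big_nil // big_cons.
by rewrite is_signM // is_signX // is_sign_legendre.
Qed.

Lemma sign_char_neq0 s v h : all (fun P => ~~ (P %| h)) s -> sign_char s v h != 0.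
Proof.
by move=> /(sign_char_sqr v); apply: contra_eqN => /eqP->; rewrite expr0n eq_sym oner_eq0.
Qed.

Lemma sign_charM s v g h : all prime_poly s ->
  sign_char s v (g * h) = sign_char s v g * sign_char s v h.
Proof.
move=> /allP prs; rewrite /sign_char -big_split /=; apply: eq_big_seq => P /prs prP.
by rewrite legendreM // exprMn.
Qed.

Lemma sign_char_mod s v g h : all prime_poly s ->
  all (fun P => P %| g - h) s -> sign_char s v g = sign_char s v h.
Proof.
move=> /allP prs /allP sgh; apply: eq_big_seq => P Ps.
by rewrite (legendre_mod _ (prs _ Ps) (sgh _ Ps)).
Qed.

Lemma sign_char1 s v : all prime_poly s -> sign_char s v 1 = 1.
Proof.
move=> /allP prs; rewrite /sign_char big_seq big1 // => P /prs prP.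
by rewrite legendre1 // expr1n.
Qed.

Lemma chinese_mod P (B r : {poly F}) : coprimep P B ->
  exists f, P %| f - r /\ B %| f - 1.
Proof.
move/Bezout_eq1_coprimepP=> [[u v] /= uv1]; exists (1 + v * B * (r - 1)).
split; last by rewrite addrAC subrr add0r mulrAC dvdp_mulIr.
have -> : 1 + v * B * (r - 1) - r = (1 - r) * (1 - v * B) by ring.
by rewrite -uv1 addrK mulrA dvdp_mulIr.
Qed.

Section Modulus.

Variables (C : numFieldType) (s : seq {poly F}) (v : {poly F} -> nat).
Hypotheses (us : uniq s) (prs : all prime_poly s) (v_gt0 : all (fun P => 0 < v P)%N s).

Lemma mult_sign_char :
  mult_char (\prod_(P <- s) P) (fun h => (sign_char s v h)%:~R : C).
Proof.
have coE h := coprime_prod_primes h prs.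
split=> [g h|h|||h].
- by rewrite prod_primes_dvd // => sgh; rewrite (sign_char_mod _ prs sgh).
- by rewrite coE intr_eq0 => /sign_char_neq0.
- by rewrite sign_char1.
- by move=> g h _ _; rewrite sign_charM // intrM.
rewrite coE => /allPn[P Ps]; rewrite negbK => Ph.
rewrite /sign_char (big_rem P) //= /legendre Ph expr0n gtn_eqF ?mul0r //.
exact: (allP v_gt0).
Qed.

End Modulus.

(** The even powers drop out on the polynomials coprime to the modulus. Each
    odd power is seen by a polynomial that is a nonresidue modulo [P] and is 1
    modulo the other primes. *)
Lemma conductor_sign_char (C : numFieldType) s v :
  uniq s -> all prime_poly s -> all (fun P => 0 < v P)%N s ->
  is_conductor (\prod_(P <- s) P) (fun h => (sign_char s v h)%:~R : C)
    (\prod_(P <- s | odd (v P)) P).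
Proof.
move=> us prs v_gt0; set s1 := [seq P <- s | odd (v P)].
have us1 : uniq s1 by exact: filter_uniq.
have prs1 : all prime_poly s1 by exact: all_prime_filter.
rewrite -[X in is_conductor _ _ X]big_filter -/s1; split; first split.
- exact: monic_prod_primes.
- rewrite prod_primes_dvd //; apply/allP => P.
  rewrite mem_filter => /andP[_ Ps]; rewrite prime_dvd_prod //.
  exact: (allP prs).
- exists (fun h => (sign_char s1 (fun=> 1%N) h)%:~R).
    by apply: mult_sign_char => //; apply/allP.
  move=> h; rewrite coprime_prod_primes // => /allP sh; congr (_%:~R).
  rewrite /sign_char big_filter [RHS]big_mkcond; apply: eq_big_seq => P /sh nPh.
  rewrite -[in LHS](odd_double_half (v P)) exprD -mul2n exprM legendre_sqr // expr1n mulr1.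
  by case: odd.
move=> E' [monE' E'E [psi mpsi psiE]].
rewrite prod_primes_dvd //; apply/allP => P; rewrite mem_filter => /andP[oddP Ps].
have prP := allP prs _ Ps; apply: contraT => nPE'.
have Es : \prod_(Q <- s) Q = P * \prod_(Q <- rem P s) Q by rewrite (big_rem P).
have prr : all prime_poly (rem P s).
  by apply/allP => Q /mem_rem Qs; exact: (allP prs).
have [r rE] := legendre_nonresidue q_odd prP.
have [|f [fr f1]] := @chinese_mod P (\prod_(Q <- rem P s) Q) r.
  by rewrite prime_poly_coprime // prime_dvd_prod // mem_rem_uniqF.
have fP : legendre P f = -1 by rewrite -rE; exact: legendre_mod.
have fQ Q : Q \in rem P s -> legendre Q f = 1.
  move=> Qs; have prQ := allP prr _ Qs; rewrite -(legendre1 prQ).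
  apply: (legendre_mod q_odd prQ); apply: dvdp_trans f1.
  by rewrite prime_dvd_prod.
have cof : coprimep f (\prod_(Q <- s) Q).
  rewrite coprime_prod_primes //; apply/allP => Q Qs; rewrite -legendre_eq0.
  have [->|QP] := eqVneq Q P; first by rewrite fP.
  by rewrite fQ // mem_rem_uniq // inE QP.
have : (sign_char s v f)%:~R = psi 1.
  rewrite psiE //; apply: (mult_char_mod mpsi); apply: dvdp_trans f1.
  by move: E'E; rewrite Es Gauss_dvdpr // coprimep_sym prime_poly_coprime.
rewrite (mult_char1 mpsi) /sign_char (big_rem P) //= fP.
rewrite (_ : \prod_(Q <- _) _ = 1); last first.
  by rewrite big_seq big1 // => Q /fQ->; rewrite expr1n.
rewrite mulr1 -signr_odd oddP expr1 mulrN1z => /eqP.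
by rewrite eqNr oner_eq0.
Qed.

End Character.

(** * Stickelberger's theorem and reciprocity for products *)

Section Jacobi.

Variable F : finFieldType.
Hypothesis q_odd : odd #|F|.
Implicit Types (P Q f g h M D : {poly F}) (s t u : seq {poly F}).
Local Notation prime_poly := (@is_prime_poly F).
Local Notation deg f := (size f).-1.
Local Notation pprod s := (\prod_(P <- s) P)%R.

Definition jacobi s f : int := \prod_(P <- s) legendre P f.

Lemma jacobiM s f g : all prime_poly s -> jacobi s (f * g) = jacobi s f * jacobi s g.
Proof.
move=> /allP prs; rewrite /jacobi -big_split /=; apply: eq_big_seq => P /prs prP.
exact: legendreM.
Qed.

Lemma jacobi_mod s f g : all prime_poly s ->
  all (fun P => P %| f - g) s -> jacobi s f = jacobi s g.
Proof.
move=> /allP prs /allP sfg; apply: eq_big_seq => P Ps.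
by rewrite (legendre_mod q_odd (prs _ Ps) (sfg _ Ps)).
Qed.

Lemma jacobi_sqr s f : all (fun P => ~~ (P %| f)) s -> jacobi s f ^+ 2 = 1.
Proof.
move=> /allP sf; rewrite /jacobi -prodrXl big_seq big1 // => P /sf nPf.
exact: legendre_sqr.
Qed.

Lemma deg_monicM f g : f \is monic -> g \is monic -> deg (f * g) = (deg f + deg g)%N.
Proof.
move=> monf mong; rewrite size_monicM ?monic_neq0 //.
have := monic_neq0 monf; have := monic_neq0 mong; rewrite -!size_poly_gt0.
by case: (size f) => // i; case: (size g) => // j; rewrite addSn addnS.
Qed.

Lemma deg_prod_cons P s : all prime_poly (P :: s) ->
  deg (pprod (P :: s)) = (deg P + deg (pprod s))%N.
Proof.
case/andP=> prP prs; rewrite big_cons deg_monicM ?monic_prod_primes //.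
exact: prime_poly_monic.
Qed.

Lemma legendre_jacobi_recip P s : prime_poly P -> all prime_poly s ->
  legendre P (pprod s) = qchar_opp1 F ^+ (deg P * deg (pprod s)) * jacobi s P.
Proof.
move=> prP; rewrite /jacobi; elim: s => [|Q s IHs] prs.
  by rewrite !big_nil legendre1 // size_poly1 muln0.
rewrite deg_prod_cons //; case/andP: prs => prQ prs.
rewrite !big_cons legendreM // IHs // (legendre_recip q_odd prP prQ) mulnDr exprD.
by ring.
Qed.

Lemma jacobi_recip s t : all prime_poly s -> all prime_poly t ->
  jacobi s (pprod t) =
  qchar_opp1 F ^+ (deg (pprod s) * deg (pprod t)) * jacobi t (pprod s).
Proof.
move=> + prt; elim: s => [|P s IHs] prs.
  rewrite /jacobi !big_nil size_poly1 mul0n big_seq big1 // => P Pt.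
  by rewrite legendre1 // (allP prt).
rewrite deg_prod_cons //; case/andP: prs => prP prs.
rewrite {1}/jacobi big_cons -/(jacobi _ _) IHs // legendre_jacobi_recip //.
by rewrite big_cons jacobiM // mulnDl exprD; ring.
Qed.

Lemma jacobi_polyC s c : all prime_poly s ->
  jacobi s c%:P = legendre 'X c%:P ^+ deg (pprod s).
Proof.
elim: s => [|P s IHs] prs; first by rewrite /jacobi !big_nil size_poly1.
rewrite deg_prod_cons //; case/andP: prs => prP prs.
by rewrite {1}/jacobi big_cons -/(jacobi _ _) IHs // legendre_polyC // exprD.
Qed.

Lemma bin2D m n : 'C(m + n, 2) = ('C(m, 2) + 'C(n, 2) + m * n)%N.
Proof.
elim: n => [|n IHn]; first by rewrite bin0n muln0 !addn0.
by rewrite addnS !binS !bin1 IHn; lia.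
Qed.

(** Stickelberger's theorem: the discriminant is multiplicative up to the
    square of a resultant, so its quadratic character is the product of those of
    the primes [P] of [f], each the sign of a cycle of length [deg P]. *)
Lemma jacobi_deriv s (f := pprod s) : all prime_poly s ->
  jacobi s f^`() = moebius f * (-1) ^+ deg f * qchar_opp1 F ^+ 'C(deg f, 2).
Proof.
rewrite {}/f; elim: s => [|P s IHs] prs.
  by rewrite moebius_prod // /jacobi !big_nil size_poly1.
rewrite deg_prod_cons // moebius_prod //=; case/andP: prs => prP prs.
rewrite {1}/jacobi !big_cons -/(jacobi _ _); set f := pprod s in IHs *.
have -> : legendre P (P * f)^`() = legendre P (P^`() * f).
  by apply: legendre_mod => //; rewrite derivM addrAC subrr add0r dvdp_mulr.
have -> : jacobi s (P * f)^`() = jacobi s (P * f^`()).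
  apply: jacobi_mod => //; apply/allP => Q Qs; rewrite derivM addrK dvdp_mull //.
  by rewrite prime_dvd_prod // (allP prs).
rewrite legendreM // jacobiM // legendre_deriv // legendre_jacobi_recip // -/f.
rewrite IHs // /f moebius_prod // -/f bin2D.
have -> : (-1) ^+ (deg P).-1 = - (-1) ^+ deg P :> int.
  by have := prime_size_gt1 prP; case: size => [|[|k]] // _; rewrite [in RHS]exprS mulN1r opprK.
have [Ps|nPs] := boolP (P \in s).
  have -> : jacobi s P = 0 by rewrite /jacobi (big_rem P Ps) /= {1}/legendre dvdpp mul0r.
  by ring.
have sP : jacobi s P ^+ 2 = 1.
  apply: jacobi_sqr; apply/allP => Q Qs; rewrite prime_dvd_prime ?(allP prs _ Qs) //.
  by apply: contraNneq nPs => <-.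
case: (uniq s) => /=; last by ring.
rewrite !exprD exprS; move: (jacobi s P) sP => j; rewrite expr2 => jj.
set A := qchar_opp1 F ^+ 'C(deg P, 2); set B := qchar_opp1 F ^+ 'C(deg f, 2).
set X := qchar_opp1 F ^+ (_ * _).
transitivity (j * j * (- (-1) ^+ deg P * A * X * (-1) ^+ size s * (-1) ^+ deg f * B)).
  by ring.
by rewrite jj; ring.
Qed.

(** The polynomial [f' M - f M'] is congruent to [f' M] modulo [f]; reciprocity
    turns the symbols modulo the primes of [f] into symbols modulo the primes
    of [D] and of [M]. *)
Lemma moebius_jacobi s t u c
    (f := pprod s) (M := pprod u) (D := f^`() * M - f * M^`()) :
  all prime_poly s -> all prime_poly t -> all prime_poly u ->
  D = c *: pprod t ->
  moebius f * (-1) ^+ deg f * qchar_opp1 F ^+ 'C(deg f, 2) *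
    (qchar_opp1 F ^+ (deg f * deg M) * jacobi u f) =
  legendre 'X c%:P ^+ deg f * (qchar_opp1 F ^+ (deg f * deg (pprod t)) * jacobi t f).
Proof.
move=> prs prt pru DE.
rewrite -!jacobi_recip // -jacobi_polyC // -jacobi_deriv // -!jacobiM //.
rewrite mul_polyC -DE; apply: jacobi_mod => //; apply/allP => P Ps.
rewrite /D opprB addrC subrK dvdp_mulr //.
by rewrite prime_dvd_prod // (allP prs).
Qed.

End Jacobi.

(** * The shift, the character and the sign *)

Section Data.

Variable F : finFieldType.
Hypothesis q_odd : odd #|F|.
Implicit Types (P Q f g h a M D E : {poly F}) (s t u : seq {poly F}).
Local Notation prime_poly := (@is_prime_poly F).
Local Notation deg f := (size f).-1.
Local Notation pprod s := (\prod_(P <- s) P)%R.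

(** Bezout's relation, divided by the constant that [egcdp] leaves as the
    greatest common divisor. *)
Definition solve_mod M E a : {poly F} :=
  let e := egcdp M E in (lead_coef (e.1 * M + e.2 * E))^-1 *: (e.1 * a).

Lemma solve_modP M E a : coprimep M E -> E %| solve_mod M E a * M - a.
Proof.
rewrite /coprimep => /eqP sg; rewrite /solve_mod.
have /eqp_size := egcdpE M E; rewrite sg; set e := egcdp M E; set G := _ + _ => sG.
have [k k0 GE] : exists2 k, k != 0 & G = k%:P.
  by have /size_poly1P := introT eqP (esym sG).
rewrite GE lead_coefC -(dvdpZr _ _ k0) scalerBr -scalerAl scalerA divff // scale1r.
have -> : e.1 * a * M - k *: a = - (e.2 * a) * E by rewrite -mul_polyC -GE /G; ring.
exact: dvdp_mull.
Qed.

Section FixedDerivative.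

Variables a M h : {poly F}.
Let D := Dpoly a M h.
Let t := prime_factors D.
Let cnt P := count_mem P t.

(** The symbols of [f = a + g * M] at the primes of [D] that divide [M] see only
    [a], so they go into the sign; the other primes carry the character. *)
Definition inner_primes := [seq P <- undup t | P %| M].
Definition outer_primes := [seq P <- undup t | ~~ (P %| M)].

Definition residue_shift : {poly F} := solve_mod M (pprod outer_primes) a.

Definition outer_char f : int := sign_char outer_primes cnt f.

(** Here [n] is the degree of [f], and it is the only trace of [g] beyond its
    derivative [h]. *)
Definition outer_sign d : int :=
  let n := maxn (d + deg M) (deg a) in
  if D == 0 then 0 else
  (-1) ^+ n * qchar_opp1 F ^+ 'C(n, 2) *
  qchar_opp1 F ^+ (n * deg M) * jacobi (prime_factors M) a *
  (legendre 'X (lead_coef D)%:P ^+ n * qchar_opp1 F ^+ (n * deg D)) *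
  (sign_char inner_primes cnt a * sign_char outer_primes cnt M).

Lemma is_sign_jacobi s f : is_sign (jacobi s f).
Proof.
rewrite /jacobi; elim: s => [|P s IHs]; rewrite ?big_nil // big_cons.
by rewrite is_signM // is_sign_legendre.
Qed.

Lemma is_sign_outer_sign d : is_sign (outer_sign d).
Proof.
rewrite /outer_sign; case: ifP => // _.
by rewrite !is_signM ?is_signX ?is_sign_jacobi ?is_sign_char ?is_sign_legendre.
Qed.

Hypotheses (monM : M \is monic) (coaM : coprimep a M).

Lemma outer_sign_eq0 d : outer_sign d = 0 <-> D = 0.
Proof.
split; last by move=> D0; rewrite /outer_sign D0 eqxx.
rewrite /outer_sign; case: eqP => // /eqP D0 /eqP.
have [pru ME] := prime_factorsP (monic_neq0 monM).
rewrite (monicP monM) scale1r in ME.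
have qN1_neq0 : qchar_opp1 F != 0 by rewrite signr_eq0.
have j0 : jacobi (prime_factors M) a != 0.
  have /jacobi_sqr : all (fun P => ~~ (P %| a)) (prime_factors M).
    by rewrite -coprime_prod_primes // -ME.
  by apply: contra_eqN => /eqP->; rewrite expr0n eq_sym oner_eq0.
have l0 : legendre 'X (lead_coef D)%:P != 0.
  have c0 : (lead_coef D)%:P != 0 by rewrite polyC_eq0 lead_coef_eq0.
  rewrite legendre_eq0; apply/negP => /(dvdp_leq c0).
  by rewrite size_polyX leqNgt ltnS size_polyC_leq1.
apply: contraTeq => _; rewrite !mulf_neq0 ?expf_neq0 ?signr_eq0 //.
  apply: sign_char_neq0; apply/allP => P; rewrite mem_filter mem_undup => /andP[PM Pt].
  have [prt _] := prime_factorsP D0; rewrite -prime_poly_coprime ?(allP prt) //.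
  by rewrite coprimep_sym; apply: coprimep_dvdl coaM.
by apply: sign_char_neq0; apply/allP => P; rewrite mem_filter => /andP[].
Qed.

Lemma jacobi_split s f (cs := fun P => count_mem P s) :
  jacobi s f = sign_char [seq P <- undup s | P %| M] cs f *
               sign_char [seq P <- undup s | ~~ (P %| M)] cs f.
Proof.
rewrite /jacobi /sign_char !big_filter.
rewrite -(big_undup_iterop_count _ s xpredT (fun P => legendre P f)).
rewrite (bigID (fun P => P %| M)) /=.
by congr (_ * _); apply: eq_bigr.
Qed.

Hypothesis D_neq0 : D != 0.

Let prt : all prime_poly t.
Proof. by case: (prime_factorsP D_neq0). Qed.

Let DE : D = lead_coef D *: pprod t.
Proof. by case: (prime_factorsP D_neq0). Qed.

Lemma uniq_outer_primes : uniq outer_primes.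
Proof. by rewrite filter_uniq ?undup_uniq. Qed.

Lemma all_prime_outer : all prime_poly outer_primes.
Proof.
apply: all_prime_filter; apply/allP => P; rewrite mem_undup; exact: (allP prt).
Qed.

Lemma count_outer_gt0 : all (fun P => 0 < cnt P)%N outer_primes.
Proof.
apply/allP => P; rewrite mem_filter mem_undup => /andP[_].
by rewrite -has_pred1 has_count.
Qed.

Let prut : all prime_poly (undup t).
Proof. by apply/allP => P; rewrite mem_undup; exact: (allP prt). Qed.

Lemma EmodE : Emod a M h = pprod outer_primes.
Proof.
have c0 : lead_coef D != 0 by rewrite lead_coef_eq0.
rewrite /Emod -/D {1 2}DE rad_factors // prod_primes_div_gcd ?undup_uniq ?monic_neq0 //.
by rewrite big_filter.
Qed.

Lemma E1modE : E1mod a M h = \prod_(P <- outer_primes | odd (cnt P)) P.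
Proof.
have c0 : lead_coef D != 0 by rewrite lead_coef_eq0.
rewrite /E1mod -/D {1 2}DE rad1_factors // -big_filter.
rewrite prod_primes_div_gcd ?filter_uniq ?undup_uniq ?monic_neq0 ?all_prime_filter //.
by rewrite !big_filter_cond; apply: eq_bigl => P; rewrite andbC.
Qed.

(** Modulo a prime that divides [M], [f] is [a]; modulo the others it is [M]
    times [residue_shift + g]. *)
Lemma outer_char_shift g :
  jacobi t (a + g * M) = sign_char inner_primes cnt a *
    (sign_char outer_primes cnt M * outer_char (residue_shift + g)).
Proof.
rewrite jacobi_split -/inner_primes -/outer_primes; congr (_ * _).
  apply: sign_char_mod => //; first exact: all_prime_filter.
  apply/allP => P; rewrite mem_filter => /andP[PM _].
  by rewrite addrAC subrr add0r dvdp_mull.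
rewrite /outer_char -sign_charM ?all_prime_outer //.
apply: sign_char_mod => //; first exact: all_prime_outer.
have coME : coprimep M (pprod outer_primes).
  by rewrite coprime_prod_primes ?all_prime_outer //; exact: filter_all.
have -> : a + g * M - M * (residue_shift + g) = - (residue_shift * M - a) by ring.
apply/allP => P Po; rewrite dvdpNr; apply: dvdp_trans (solve_modP a coME).
by rewrite prime_dvd_prod ?all_prime_outer // (allP all_prime_outer).
Qed.

End FixedDerivative.

Lemma monic_add_mul a g M (n := maxn (deg g + deg M) (deg a)) :
  a \is monic -> g \is monic -> M \is monic -> deg a <> (deg g + deg M)%N ->
  a + g * M \is monic /\ deg (a + g * M) = n.
Proof.
move=> mona mong monM adeg.
have dgM := deg_monicM mong monM.
have a_gt0 : (0 < size a)%N by rewrite size_poly_gt0 monic_neq0.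
have mongM : g * M \is monic by rewrite rpredM.
have gM_gt0 : (0 < size (g * M)%R)%N by rewrite size_poly_gt0 monic_neq0.
have [lt|lt|//] := ltngtP (deg a) (deg g + deg M).
  have slt : (size a < size (g * M)%R)%N by lia.
  rewrite /n (maxn_idPl (ltnW lt)) addrC -dgM.
  by split; rewrite ?monicE ?lead_coefDl -?monicE // size_polyDl.
have slt : (size (g * M)%R < size a)%N by lia.
rewrite /n (maxn_idPr (ltnW lt)).
by split; rewrite ?monicE ?lead_coefDl -?monicE // size_polyDl.
Qed.

Lemma moebius_eq a M g (h := g^`()) :
  a \is monic -> g \is monic -> M \is monic -> coprimep a M ->
  (0 < deg g)%N -> deg a <> (deg g + deg M)%N ->
  moebius (a + g * M) =
    outer_sign a M h (deg g) * outer_char a M h (residue_shift a M h + g).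
Proof.
move=> mona mong monM coaM g_gt0 adeg; set f := a + g * M.
have [monf degf] := monic_add_mul mona mong monM adeg; rewrite -/f in monf degf.
have n_gt0 : (0 < deg f)%N by rewrite degf leq_max addn_gt0 g_gt0.
set D := Dpoly a M h.
have DfM : D = f^`() * M - f * M^`().
  by rewrite /D /Dpoly /f /h derivD derivM; ring.
have [prs fE] := prime_factorsP (monic_neq0 monf).
rewrite (monicP monf) scale1r in fE; set s := prime_factors f in prs fE.
have [pru ME] := prime_factorsP (monic_neq0 monM).
rewrite (monicP monM) scale1r in ME; set u := prime_factors M in pru ME.
have ju : jacobi u f = jacobi u a.
  apply: jacobi_mod => //; apply/allP => P Pu.
  rewrite /f addrAC subrr add0r dvdp_mull // ME prime_dvd_prod //.
  exact: (allP pru).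
have ja : jacobi u a ^+ 2 = 1.
  by apply: jacobi_sqr; rewrite -coprime_prod_primes // -ME.
have sign2 k : (qchar_opp1 F ^+ k) ^+ 2 = 1 by rewrite exprAC qchar_opp1_sqr expr1n.
(* Signs are their own inverses. *)
have solve (x y z j m r : int) : x ^+ 2 = 1 -> y ^+ 2 = 1 -> z ^+ 2 = 1 ->
    j ^+ 2 = 1 -> m * x * y * (z * j) = r -> m = x * y * z * j * r.
  move=> x2 y2 z2 j2 <-.
  have -> : x * y * z * j * (m * x * y * (z * j)) =
    m * x ^+ 2 * y ^+ 2 * z ^+ 2 * j ^+ 2 by ring.
  by rewrite x2 y2 z2 j2 !mulr1.
have main t c : all (@is_prime_poly F) t -> D = c *: pprod t ->
    moebius f = (-1) ^+ deg f * qchar_opp1 F ^+ 'C(deg f, 2) *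
      qchar_opp1 F ^+ (deg f * deg M) * jacobi u a *
      (legendre 'X c%:P ^+ deg f * (qchar_opp1 F ^+ (deg f * deg (pprod t)) * jacobi t f)).
  move=> prt DE; apply: solve => //; first exact: sqrr_sign.
  rewrite -ju; have := @moebius_jacobi F q_odd s t u c prs prt pru.
  by rewrite -fE -ME -DfM => /(_ DE).
rewrite /outer_sign -/D -/u -degf; case: eqP => [D0|/eqP D0].
  (* As n > 0, the n-th power of the symbol of the leading coefficient 0 is 0. *)
  rewrite (main [::] 0) //; last by rewrite scale0r.
  by rewrite /legendre dvdp0 expr0n gtn_eqF // !(mul0r, mulr0).
have [prt DE] := prime_factorsP D0; rewrite (main _ _ prt DE).
have -> : size (pprod (prime_factors D)) = size D.
  by rewrite [in RHS]DE size_scale // lead_coef_eq0.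
by rewrite (outer_char_shift D0); ring.
Qed.

End Data.

Theorem lemma3p2 (R : realType) (F : finFieldType) (p e : nat)
    (p_prime : prime p) (p_odd : odd p) (cardF : #|F| = (p ^ e)%N) :
  exists (w : {poly F} -> {poly F} -> {poly F} -> {poly F})
         (chi : {poly F} -> {poly F} -> {poly F} -> {poly F} -> R[i])
         (S : nat -> {poly F} -> {poly F} -> {poly F} -> int),
  forall (m k d : nat) (M g a : {poly F}),
    (1 <= d)%N -> k <> (d + m)%N ->
    M \is monic -> size M = m.+1 ->
    g \is monic -> size g = d.+1 ->
    a \is monic -> size a = k.+1 -> coprimep a M ->
    [/\ S d a M g^`() \in [:: 0; 1; -1],
        S d a M g^`() = 0 <-> Dpoly a M g^`() = 0,
        Dpoly a M g^`() = 0 -> moebius (a + g * M) = 0 &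
        Dpoly a M g^`() <> 0 ->
          [/\ mult_char (Emod a M g^`()) (chi a M g^`()),
              real_char (chi a M g^`()),
              is_conductor (Emod a M g^`()) (chi a M g^`()) (E1mod a M g^`()) &
              (moebius (a + g * M))%:~R =
                (S d a M g^`())%:~R * chi a M g^`() (w a M g^`() + g)]].
Proof.
have q_odd : odd #|F| by rewrite cardF oddX p_odd orbT.
exists (fun a M h => residue_shift a M h), (fun a M h f => (outer_char a M h f)%:~R),
  (fun d a M h => outer_sign a M h d).
move=> m k d M g a d_gt0 kdm monM sM mong sg mona sa coaM.
have S0 := outer_sign_eq0 g^`() monM coaM d.
have muE : moebius (a + g * M) =
    outer_sign a M g^`() d * outer_char a M g^`() (residue_shift a M g^`() + g).
  by have := moebius_eq q_odd mona mong monM coaM; rewrite sg sM sa; apply.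
split=> //; first exact: is_sign_outer_sign.
  by move=> D0; rewrite muE S0.2 ?mul0r.
move=> /eqP D0; have us := uniq_outer_primes a M g^`().
have prs := all_prime_outer D0; have v_gt0 := count_outer_gt0 a M g^`().
rewrite (EmodE monM D0) (E1modE monM D0); split.
- exact: mult_sign_char.
- by move=> f; exact: realz.
- exact: conductor_sign_char.
by rewrite muE intrM.
Qed.
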